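(* Let $p,q\in\mathbb{Q}[z]$ be monic polynomials of degree $d$, each with distinct roots, $p(z)=\prod_{i=1}^d(z-\alpha_i)$, $q(z)=\prod_{j=1}^d(z-\beta_j)$ with $\alpha_i,\beta_j\in\mathbb{C}$, and let $\phi,\psi\in\mathrm{Sym}(d)$ be the permutations with $\alpha_{\phi(i)}=\overline{\alpha_i}$ and $\beta_{\psi(j)}=\overline{\beta_j}$ for all $i,j$; put $\iota=(\phi,\psi)$. Suppose $M$ is a vertex of the $\iota$-invariant Birkhoff polytope $B_d^\iota$ that minimizes $\mathrm{cost}(\cdot,p,q)$ over $B_d^\iota$, and let $\Gamma$ be the graph associated to $M$. Let $\Phi_{p,q}:\mathbb{Q}[x_1,\dots,x_d,y_1,\dots,y_d,t]\to\mathbb{C}[t]$ be the $\mathbb{Q}$-algebra homomorphism with $x_i\mapsto\alpha_i$, $y_j\mapsto\beta_j$, $t\mapsto t$. Then $\Phi_{p,q}(h_M)\in\mathbb{Q}[t]$, and $W_2^2(p,q)$ is a root of $\Phi_{p,q}(h_M)$. In particular, the algebraic degree of $W_2^2(p,q)$ (the degree of its minimal polynomial over $\mathbb{Q}$) is at most $\dfrac{(d!)^2}{|\mathrm{Aut}_\iota(\Gamma)|}$.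
   Context: $B_d$ denotes the Birkhoff polytope of $d\times d$ doubly stochastic matrices (nonnegative real entries, all row and column sums equal to $1$). The $\iota$-invariant Birkhoff polytope is $B_d^\iota=\{M\in B_d: M_{ij}=M_{\phi(i)\psi(j)}\ \forall i,j\}$. Cost and Wasserstein distance: for $M\in B_d$, $\mathrm{cost}(M,p,q)=\frac1d\sum_{1\le i,j\le d}M_{ij}\,\|\alpha_i-\beta_j\|^2$, where $\|\cdot\|$ is the Euclidean norm (absolute value) on $\mathbb{C}$, and $W_2^2(p,q)=\min_{M\in B_d}\mathrm{cost}(M,p,q)$ (the squared Wasserstein distance of the uniform measures on the roots of $p$ and of $q$). Graph: every vertex $M$ of $B_d^\iota$ has entries in $\{0,\frac12,1\}$. The associated graph $\Gamma$ is the bipartite multigraph with vertex set $[d]\times\{L,R\}$ in which $(i,L)$ and $(j,R)$ are joined by $2M_{ij}$ edges. The involution $\iota$ acts on it by $\iota(i,L)=(\phi(i),L)$, $\iota(j,R)=(\psi(j),R)$. Group: $G=\mathrm{Sym}(d)\times\mathrm{Sym}(d)$ acts on $[d]\times\{L,R\}$ by $(g_1,g_2)\cdot(i,L)=(g_1(i),L)$, $(g_1,g_2)\cdot(j,R)=(g_2(j),R)$, and on $A=\mathbb{Q}[x_1,\dots,x_d,y_1,\dots,y_d]$ by $(g_1,g_2)\cdot x_i=x_{g_1(i)}$, $(g_1,g_2)\cdot y_j=y_{g_2(j)}$. $\mathrm{Aut}_\iota(\Gamma)$ is the group of automorphisms of $\Gamma$ (permutations of the vertices preserving edge multiplicities)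 that preserve both sides $L$ and $R$ and commute with $\iota$; it is viewed as a subgroup of $G$. Polynomials: $f_M=\frac1d\sum_{1\le i,j\le d}M_{ij}(x_i-y_j)(x_{\phi(i)}-y_{\psi(j)})\in A$. The stabilizer of $f_M$ in $G$ is $\mathrm{Aut}_\iota(\Gamma)$, and $h_M=\prod_{g\in G/\mathrm{Aut}_\iota(\Gamma)}(g(f_M)-t)\in A[t]$ (product over left cosets). *)

(* Defs.v *)
From HB Require Import structures.
From mathcomp Require Import all_boot all_order all_algebra all_fingroup.
From mathcomp Require Import mpoly.
From mathcomp Require Import boolp classical_sets reals topology normedtype.
From mathcomp Require Import complex.

Set Implicit Arguments.
Unset Strict Implicit.
Unset Printing Implicit Defensive.

Import Order.TTheory GRing.Theory Num.Theory.
Import numFieldNormedType.Exports.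

Local Open Scope ring_scope.

Section Birkhoff.
Variables (R : realType) (d : nat).
Implicit Types (M N : 'M[R]_d) (phi psi : 'S_d) (alpha beta : 'I_d -> R[i]).

Definition Birkhoff : set 'M[R]_d :=
  [set M : 'M[R]_d | [/\ forall i j, 0 <= M i j,
      forall i, \sum_j M i j = 1 & forall j, \sum_i M i j = 1]]%classic.

Definition iBirkhoff phi psi : set 'M[R]_d :=
  [set M : 'M[R]_d | Birkhoff M /\
      forall i j, M i j = M (phi i) (psi j)]%classic.

(* Vertices of a polytope, as its extreme points. *)
Definition is_vertex (P : set 'M[R]_d) M : Prop :=
  P M /\ forall N1 N2 (s : R), P N1 -> P N2 -> 0 < s < 1 ->
    M = s *: N1 + (1 - s) *: N2 -> N1 = M /\ N2 = M.

(* In [R[i]] the modulus [`|z|] is itself an element of [R[i]], with zero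
   imaginary part. *)
Definition cost alpha beta M : R :=
  d%:R^-1 * \sum_i \sum_j M i j * complex.Re `|alpha i - beta j| ^+ 2.

Definition minimizes (P : set 'M[R]_d) (c : 'M[R]_d -> R) M : Prop :=
  P M /\ forall N, P N -> c M <= c N.

(* The infimum is a minimum: see [W2sq_min]. *)
Definition W2sq alpha beta : R := inf (cost alpha beta @` Birkhoff)%classic.

Lemma W2sq_min alpha beta :
  exists2 M, minimizes Birkhoff (cost alpha beta) M &
    cost alpha beta M = W2sq alpha beta.
Proof.
pose c := cost alpha beta.
pose K : set 'rV[R]_(d * d) := [set v | Birkhoff (vec_mx v)]%classic.
pose box := [set v : 'rV[R]_(d * d) |
  forall k, (`[0, 1]%classic : set R) (v ord0 k)]%classic.
have vE (v : 'rV[R]_(d * d)) i j : vec_mx v i j = v ord0 (mxvec_index i j).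
  by rewrite mxE.
have coordC i j : continuous (fun v : 'rV[R]_(d * d) => vec_mx v i j).
  move=> v; under eq_fun do rewrite vE; exact: coord_continuous.
have sumC (f : 'I_d -> 'rV[R]_(d * d) -> R) : (forall i, continuous (f i)) ->
    continuous (fun v => \sum_i f i v).
  move=> fC; elim: (index_enum _) => [|i r IHr].
    rewrite [X in continuous X](_ : _ = fun=> 0).
      by move=> v; exact: cst_continuous.
    by apply/funext => v; rewrite big_nil.
  rewrite [X in continuous X](_ : _ = fun v => f i v + \sum_(j <- r) f j v).
    by move=> v; apply: continuousD; [exact: fC | exact: IHr].
  by apply/funext => v; rewrite big_cons.
have cK : compact K.
  have cbox : compact box.
    apply: (@rV_compact R _ (fun=> `[(0 : R), 1]%classic)) => k.
    exact: segment_compact.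
  apply: (subclosed_compact _ cbox _).
    have -> : K = (\bigcap_(k in [set: 'I_d * 'I_d])
        [set v : 'rV[R]_(d * d) | (0 : R) <= vec_mx v k.1 k.2]
      `&` (\bigcap_(i in [set: 'I_d])
        [set v : 'rV[R]_(d * d) | \sum_j vec_mx v i j = (1 : R)]
      `&` \bigcap_(j in [set: 'I_d])
        [set v : 'rV[R]_(d * d) | \sum_i vec_mx v i j = (1 : R)]))%classic.
      apply/seteqP; split=> v.
        by case=> h1 h2 h3; split; [|split] => k _ /=.
      case=> h1 [h2 h3]; split.
      - by move=> i j; exact: (h1 (i, j)).
      - by move=> i; exact: (h2 i).
      - by move=> j; exact: (h3 j).
    apply: closedI; [|apply: closedI]; apply: closed_bigI => k _.
    - apply: (@preimage_closed _ _ _ [set x : R | 0 <= x]%classic).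
        by move=> v _; exact: coordC.
      exact: closed_ge.
    - apply: (@preimage_closed _ _ _ [set x : R | x = 1]%classic);
        last exact: closed_eq.
      by move=> v _; apply: sumC => j; exact: coordC.
    - apply: (@preimage_closed _ _ _ [set x : R | x = 1]%classic);
        last exact: closed_eq.
      by move=> v _; apply: sumC => i; exact: coordC.
  move=> v [h1 h2 _] k /=; case/mxvec_indexP: k => i j.
  rewrite -vE in_itv /= h1 /= -(h2 i) (bigD1 j) //= lerDl.
  by apply: sumr_ge0 => l _; exact: h1.
have cC : continuous (c \o vec_mx).
  have iC : continuous (fun v : 'rV[R]_(d * d) => \sum_i \sum_j
      vec_mx v i j * complex.Re `|alpha i - beta j| ^+ 2).
    apply: (sumC) => i; apply: (sumC) => j v.
    by apply: (@continuousM R _ (fun w => vec_mx w i j) (fun=> _));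
      [exact: coordC | exact: cst_continuous].
  by move=> v; apply: (@continuousM R _ (fun=> _)); [exact: cst_continuous | exact: iC].
have cI : compact (c @` Birkhoff)%classic.
  have -> : (c @` Birkhoff = (c \o vec_mx) @` K)%classic.
    apply/seteqP; split=> x [].
      by move=> M BM <-; exists (mxvec M); rewrite /K /= ?mxvecK.
    by move=> v Kv <-; exists (vec_mx v).
  by apply: continuous_compact => //; apply: continuous_subspaceT.
have B1 : Birkhoff (1%:M : 'M[R]_d).
  split=> [i j|i|j]; first by rewrite mxE; case: eqP.
    rewrite (bigD1 i) //= mxE eqxx big1 ?addr0 // => j ji.
    by rewrite mxE eq_sym (negPf ji).
  rewrite (bigD1 j) //= mxE eqxx big1 ?addr0 // => i ij.
  by rewrite mxE (negPf ij).
have c0 M : Birkhoff M -> 0 <= c M.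
  case=> M0 _ _; rewrite mulr_ge0 ?invr_ge0 //.
  apply: sumr_ge0 => i _; apply: sumr_ge0 => j _.
  by rewrite mulr_ge0 // sqr_ge0.
have hI : has_inf (c @` Birkhoff)%classic.
  split; first by exists (c 1%:M), 1%:M.
  by exists 0 => _ [M BM <-]; exact: c0.
have [M BM cM] : (c @` Birkhoff)%classic (W2sq alpha beta).
  apply: (compact_closed (@Rhausdorff R) cI).
  move=> U /nbhs_ballP[e e0 eU].
  have [x Sx xe] := inf_adherent e0 hI.
  exists x; split=> //; apply: eU; rewrite -ball_normE /= ltr_norml.
  have := ge_inf hI.2 Sx; rewrite -/(W2sq alpha beta).
  move: xe; rewrite -[inf _]/(W2sq alpha beta) => xe xge.
  apply/andP; split.
    by rewrite ltrNl opprB ltrBlDl.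
  by apply: le_lt_trans e0; rewrite subr_le0.
exists M => //; split=> // N BN; rewrite [cost _ _ M]cM.
by apply: ge_inf hI.2 _ _; exists N.
Qed.

End Birkhoff.

Section Graph.
Variables (R : realType) (d : nat).
Implicit Types (M : 'M[R]_d) (phi psi : 'S_d).

(* [inl i] stands for (i, L) and [inr j] for (j, R). *)
Definition gvertex : finType := ('I_d + 'I_d)%type.

(* The number 2 M_ij of edges, as a natural number; the truncation is harmless
   when M_ij is a half-integer, as it is at the vertices of the invariant
   Birkhoff polytope: see [halfE]. *)
Definition edges M (i j : 'I_d) : nat := Num.truncn (2 * M i j).

Definition graph M (u v : gvertex) : nat :=
  match u, v with
  | inl i, inr j | inr j, inl i => edges M i j
  | _, _ => 0%N
  end.

Definition gact (g : 'S_d * 'S_d) (v : gvertex) : gvertex :=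
  match v with inl i => inl (g.1 i) | inr j => inr (g.2 j) end.

(* Permutations of the vertices preserving both sides are exactly the [gact g];
   the involution is [gact (phi, psi)]. *)
Definition AutI M phi psi : {set 'S_d * 'S_d} :=
  [set g : 'S_d * 'S_d |
    [forall u, forall v, graph M (gact g u) (gact g v) == graph M u v] &&
    [forall v, gact g (gact (phi, psi) v) == gact (phi, psi) (gact g v)]]%SET.

Lemma gact1 v : gact 1%g v = v.
Proof. by case: v => i /=; rewrite perm1. Qed.

Lemma gactM g h v : gact (g * h)%g v = gact h (gact g v).
Proof. by case: v => i /=; rewrite permM. Qed.

Lemma AutI_group_set M phi psi : group_set (AutI M phi psi).
Proof.
apply/group_setP; split.
  rewrite inE; apply/andP; split.
    by apply/forallP=> u; apply/forallP=> v; rewrite !gact1.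
  by apply/forallP=> v; rewrite !gact1.
move=> g h; rewrite !inE => /andP[/forallP gM /forallP gI].
move=> /andP[/forallP hM /forallP hI]; apply/andP; split.
  apply/forallP=> u; apply/forallP=> v; rewrite !gactM.
  by rewrite (eqP (forallP (hM _) _)) (eqP (forallP (gM _) _)).
by apply/forallP=> v; rewrite !gactM (eqP (gI _)) (eqP (hI _)).
Qed.

Canonical AutI_group M phi psi := Group (AutI_group_set M phi psi).

End Graph.

Section Polynomials.
Variables (R : realType) (d : nat).
Implicit Types (M : 'M[R]_d) (phi psi : 'S_d) (alpha beta : 'I_d -> R[i]).

(* The ring A: the first [d] variables are the x_i, the last [d] the y_j. *)
Definition A := {mpoly rat[d + d]}.

Definition X_ (v : gvertex d) : A := 'X_(unsplit v).
Definition x_ (i : 'I_d) : A := X_ (inl i).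
Definition y_ (j : 'I_d) : A := X_ (inr j).

Definition polyact (g : 'S_d * 'S_d) (f : A) : A :=
  f \mPo [tuple X_ (gact g (split k)) | k < d + d].

(* M_ij as a rational number: half the number of edges. *)
Definition ratM M (i j : 'I_d) : rat := (edges M i j)%:R / 2.

Lemma halfE M i j : M i j \in [:: 0; 2^-1; 1] ->
  (edges M i j)%:R = 2 * M i j /\ ratr (ratM M i j) = M i j.
Proof.
move=> hM; suff e : (edges M i j)%:R = 2 * M i j.
  split=> //; rewrite /ratM fmorph_div /= !ratr_nat e mulrC mulKf //.
  by rewrite pnatr_eq0.
rewrite /edges; move: hM; rewrite !inE => /or3P[] /eqP ->.
- by rewrite mulr0 truncn0.
- by rewrite divff ?pnatr_eq0// truncn1.
- by rewrite mulr1 natrK.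
Qed.

Definition fM M phi psi : A :=
  (d%:R^-1 : rat) *: \sum_i \sum_j
    ratM M i j *: ((x_ i - y_ j) * (x_ (phi i) - y_ (psi j))).

(* Permutations compose from left to right here, [(g * h) i = h (g i)]: a left
   coset of the stabilizer for the usual composition is an [rcoset]. *)
Definition hM M phi psi : {poly A} :=
  \prod_(C in rcosets (AutI M phi psi) [set: 'S_d * 'S_d])
    ((polyact (repr C) (fM M phi psi))%:P - 'X).

(* Q[x, y, t] is [{poly A}], t being its variable ['X]. *)
Definition Phi alpha beta (h : {poly A}) : {poly R[i]} :=
  map_poly (mmap (ratr : rat -> R[i])
    (fun k => match split k with inl i => alpha i | inr j => beta j end)) h.

End Polynomials.

Definition is_minpoly (F : numFieldType) (x : F) (m : {poly rat}) : Prop :=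
  [/\ m \is monic, root (map_poly ratr m) x &
      forall r : {poly rat}, r != 0 -> root (map_poly ratr r) x ->
        (size m <= size r)%N].

Definition has_alg_degree (F : numFieldType) (x : F) (n : nat) : Prop :=
  exists2 m, is_minpoly x m & size m = n.+1.

(* Main.v *)
Require Import Defs.
From HB Require Import structures.
From mathcomp Require Import boolp classical_sets reals.
From mathcomp Require Import all_boot all_order all_algebra all_fingroup.
From mathcomp Require Import mpoly complex ring lra.

Set Implicit Arguments.
Unset Strict Implicit.
Unset Printing Implicit Defensive.

Import Order.TTheory GRing.Theory Num.Theory.

(** The squared distance is the value of [f_M] at the roots.  Averaging an
optimal doubly stochastic matrix with its image under the pair of conjugations
leaves the cost unchanged, so the minimum over the Birkhoff polytope is attained
on the invariant part, hence at [M] ([cost_iBirkhoff_min]).  Since [phi] and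
[psi] realise complex conjugation, the factor
[(x_(phi i) - y_(psi j))] evaluates to the conjugate of [alpha i - beta j], and
[f_M] evaluates to the cost of [M] ([fM_value_cost]).  This uses that [M], which
enters [f_M] only through the integers [edges M i j], has entries in
{0, 1/2, 1}: a vertex of the invariant polytope is the average of a permutation
matrix and its conjugate ([vertex_half_integral]), the permutation being found
inside the support of [M] by the marriage theorem ([hall_matching]).

Evaluated at the roots, the polynomial [h_M] is a product over right cosets of
the automorphism group of factors [fM_value (repr C) - t], where [fM_value g] is
the value of [g f_M] and depends only on the coset of [g] ([fM_value_AutI]).
Permuting the roots of [p] and those of [q] by [s] replaces [fM_value g] by
[fM_value (g * s)], which only permutes the cosets; so the product is unchanged
([Phi_hM_comp]).
A polynomial expression in the roots with this invariance equals its average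
over all pairs of permutations of the roots.  Monomial by monomial that average
is a product of a symmetric function of the roots of [p] and one of the roots of
[q], so it is rational by the fundamental theorem on symmetric polynomials
([rational_valuation]).

The trivial coset contributes the factor [W2sq - t], which gives the root, and
the number of factors is the index of the automorphism group, which bounds the
degree of the minimal polynomial. *)

(** * The marriage theorem *)

(** Induction on the cardinal of [A], in two cases.  If some proper nonempty [S]
is tight, with exactly as many neighbours as elements, then [S] is matched into
its neighbours and [A :\: S] outside of them: counting the neighbours of
[S :|: B] gives the condition for [B].  If no such [S] exists, any edge can be
chosen: removing its two ends costs each remaining set at most one neighbour. *)
Lemma hall_matching (T U : finType) (f0 : T -> U) (N : T -> {set U})
    (A : {set T}) :
  (forall S : {set T}, S \subset A -> #|S| <= #|\bigcup_(i in S) N i|) ->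
  exists f : T -> U, {in A &, injective f} /\ {in A, forall i, f i \in N i}.
Proof.
have [n] := ubnP #|A|; elim: n N A => // n IHn N A ltA hallA.
have [A0|[a aA]] := set_0Vmem A.
  by exists f0; split=> i; rewrite A0 inE.
case: (boolP [exists S : {set T},
    [&& S \proper A, S != set0 & #|\bigcup_(i in S) N i| <= #|S|]]).
  case/existsP=> S /and3P[SA S0 leS].
  have sSA := proper_sub SA.
  have [f [finj fN]] : exists f : T -> U,
      {in S &, injective f} /\ {in S, forall i, f i \in N i}.
    apply: IHn => [|B sBS]; last by apply: hallA; apply: subset_trans sSA.
    by rewrite -ltnS; apply: leq_trans ltA; rewrite ltnS proper_card.
  pose W := \bigcup_(i in S) N i.
  have [g [ginj gN]] : exists g : T -> U, {in A :\: S &, injective g} /\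
      {in A :\: S, forall i, g i \in N i :\: W}.
    apply: IHn => [|B sB].
      rewrite -ltnS; apply: leq_trans ltA; rewrite ltnS.
      rewrite -[X in _ < X](cardsID S A) (setIidPr sSA) -[X in X < _]add0n.
      by rewrite ltn_add2r card_gt0.
    have disj : [disjoint S & B].
      rewrite -setI_eq0; apply/eqP/setP=> i; rewrite !inE.
      by apply/andP=> -[iS /(subsetP sB)]; rewrite inE iS.
    have sSB : S :|: B \subset A.
      by rewrite subUset sSA (subset_trans sB) ?subsetDl.
    have := hallA _ sSB.
    rewrite cardsU (disjoint_setI0 disj) cards0 subn0 => le1.
    have sub : \bigcup_(i in S :|: B) N i
        \subset W :|: \bigcup_(i in B) (N i :\: W).
      apply/bigcupsP=> i; rewrite inE => /orP[iS|iB].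
        by apply: subset_trans (subsetUl _ _); apply: (bigcup_max i).
      apply/subsetP=> j jN; rewrite inE; case: (boolP (j \in W)) => //= jW.
      by apply/bigcupP; exists i => //; rewrite inE jW.
    have := leq_trans (subset_leq_card sub) (leq_card_setU _ _).
    move/(leq_trans le1)/leq_trans/(_ (leq_add leS (leqnn _))).
    by rewrite leq_add2l.
  have memW i : i \in S -> f i \in W.
    by move=> iS; apply/bigcupP; exists i => //; apply: fN.
  have memWC i : i \in A -> i \notin S -> (g i \in N i) && (g i \notin W).
    move=> iA iS; have := gN i; rewrite !inE iA iS => /(_ isT).
    by case/andP=> -> ->.
  exists (fun i => if i \in S then f i else g i); split=> [i j iA jA|i iA].
    case: ifPn => iS; case: ifPn => jS.
    - exact: finj.
    - by move=> e; case/andP: (memWC j jA jS) => _; rewrite -e memW.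
    - by move=> e; case/andP: (memWC i iA iS) => _; rewrite e memW.
    - by apply: ginj; rewrite inE ?iS ?jS.
  by case: ifPn => iS; [apply: fN | case/andP: (memWC i iA iS)].
(* Every proper nonempty subset of [A] has a neighbour to spare. *)
rewrite negb_exists => /forallP slack.
have [b bN] : exists b, b \in N a.
  have := hallA [set a]; rewrite sub1set big_set1 cards1 => /(_ aA).
  by case/card_gt0P=> b; exists b.
have [g [ginj gN]] : exists g : T -> U, {in A :\ a &, injective g} /\
    {in A :\ a, forall i, g i \in N i :\ b}.
  apply: IHn => [|B sB].
    rewrite -ltnS; apply: leq_trans ltA; rewrite ltnS.
    by rewrite [X in _ < X](cardsD1 a) aA.
  have [->|B0] := eqVneq B set0; first by rewrite cards0.
  have pB : B \proper A by apply: sub_proper_trans sB (properD1 aA).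
  have := slack B; rewrite pB B0 /= -ltnNge => lt1.
  have sub : (\bigcup_(i in B) N i) :\ b \subset \bigcup_(i in B) (N i :\ b).
    apply/subsetP=> j; rewrite !inE => /andP[jb /bigcupP[i iB jN]].
    by apply/bigcupP; exists i => //; rewrite !inE jb.
  apply: leq_trans (subset_leq_card sub).
  move: lt1; rewrite (cardsD1 b); case: (b \in _) => //=.
  by rewrite add0n => /ltnW.
exists (fun i => if i == a then b else g i); split=> [i j iA jA|i iA].
  case: (eqVneq i a) => [->|ia]; case: (eqVneq j a) => [->|ja] //.
  - by move=> e; have := gN j; rewrite !inE ja jA -e eqxx => /(_ isT).
  - by move=> e; have := gN i; rewrite !inE ia iA e eqxx => /(_ isT).
  - by apply: ginj; rewrite !inE ?ia ?ja.
case: (eqVneq i a) => [->//|ia].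
by have := gN i; rewrite !inE ia iA => /(_ isT) /andP[].
Qed.

Local Open Scope ring_scope.

(** * Invariant doubly stochastic matrices *)

Section SymmetricBirkhoff.
Variables (R : realType) (d : nat).
Implicit Types (M N : 'M[R]_d) (phi psi : 'S_d).

Definition twist phi psi M : 'M[R]_d := \matrix_(i, j) M (phi i) (psi j).

Definition symmetrize phi psi M : 'M[R]_d :=
  2^-1 *: (M + twist phi psi M).

Lemma Birkhoff_twist phi psi M : Birkhoff M -> Birkhoff (twist phi psi M).
Proof.
move=> [M0 Mr Mc]; split=> [i j|i|j]; first by rewrite mxE.
  under eq_bigr do rewrite mxE.
  by rewrite -(Mr (phi i)) [RHS](reindex_inj (@perm_inj _ psi)).
under eq_bigr do rewrite mxE.
by rewrite -(Mc (psi j)) [RHS](reindex_inj (@perm_inj _ phi)).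
Qed.

Lemma Birkhoff_perm_mx (s : 'S_d) : Birkhoff (perm_mx s : 'M[R]_d).
Proof.
split=> [i j|i|j]; first by rewrite !mxE ler0n.
  rewrite (bigD1 (s i)) //= !mxE eqxx big1 ?addr0 // => j /negPf ji.
  by rewrite !mxE eq_sym ji.
rewrite (bigD1 (s^-1%g j)) //= !mxE permKV eqxx big1 ?addr0 // => i ij.
by rewrite !mxE -(inj_eq (@perm_inj _ s^-1%g)) permK (negPf ij).
Qed.

Lemma Birkhoff_symmetrize phi psi M :
  Birkhoff M -> Birkhoff (symmetrize phi psi M).
Proof.
move=> BM; have [M0 Mr Mc] := BM.
have [T0 Tr Tc] := Birkhoff_twist phi psi BM.
have half2 : 2^-1 * (1 + 1) = 1 :> R by rewrite mulVf // pnatr_eq0.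
split=> [i j|i|j].
- by rewrite !mxE mulr_ge0 ?invr_ge0 ?ler0n // addr_ge0.
- under eq_bigr do rewrite 2!mxE.
  by rewrite -mulr_sumr big_split /= Mr Tr half2.
- under eq_bigr do rewrite 2!mxE.
  by rewrite -mulr_sumr big_split /= Mc Tc half2.
Qed.

Lemma iBirkhoff_symmetrize phi psi M :
  involutive phi -> involutive psi -> Birkhoff M ->
  iBirkhoff phi psi (symmetrize phi psi M).
Proof.
move=> phiK psiK BM; split; first exact: Birkhoff_symmetrize.
by move=> i j; rewrite !mxE phiK psiK addrC.
Qed.

(** The marriage condition holds for the support: the rows in [S] carry a total
mass of [#|S|], all of it in the columns of [W], which can hold only [#|W|]. *)
Lemma Birkhoff_positive_perm M :
  Birkhoff M -> exists s : 'S_d, forall i, 0 < M i (s i).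
Proof.
move=> [M0 Mr Mc].
have [|f [finj fN]] := @hall_matching _ _ (@id 'I_d)
    (fun i => [set j | 0 < M i j]%SET) [set: 'I_d]%SET.
  move=> S _; set W := \bigcup_(i in S) _; rewrite -(ler_nat R).
  have -> : #|S|%:R = \sum_(i in S) \sum_(j in W) M i j.
    rewrite -sum1_card natr_sum; apply: eq_bigr => i iS.
    rewrite -(Mr i) (bigID (mem W)) /= [X in _ + X]big1 ?addr0 // => j jW.
    apply/eqP; rewrite eq_le M0 andbT leNgt; apply: contra jW => Mij.
    by apply/bigcupP; exists i; rewrite ?inE.
  rewrite exchange_big /= -sum1_card natr_sum; apply: ler_sum => j _.
  by rewrite -(Mc j) [X in _ <= X](bigID (mem S)) /= lerDl sumr_ge0.
have inj : injective f by move=> i j; apply: finj; rewrite inE.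
exists (perm inj) => i; rewrite permE.
by have := fN i; rewrite !inE => ->.
Qed.

(** Let [S] be the symmetrization of a permutation matrix supported in the
support of [M].  By invariance [S] is itself supported there, so [M] is a proper
convex combination of [S] and of another point of the polytope; an extreme point
must then be equal to [S], whose entries are half-integers. *)
Lemma vertex_half_integral phi psi M i j :
  involutive phi -> involutive psi -> is_vertex (iBirkhoff phi psi) M ->
  M i j \in [:: 0; 2^-1; 1].
Proof.
move=> phiK psiK [[BM Minv] Mext]; have [M0 Mr Mc] := BM.
have [s spos] := Birkhoff_positive_perm BM.
have [S [[BS Sinv] SE]] : exists S : 'M[R]_d, iBirkhoff phi psi S /\
    forall k l, S k l = 2^-1 * ((s k == l)%:R + (s (phi k) == psi l)%:R).
  exists (symmetrize phi psi (perm_mx s)); split.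
    by apply: iBirkhoff_symmetrize => //; exact: Birkhoff_perm_mx.
  by move=> k l; rewrite !mxE.
have [S0 Sr Sc] := BS.
(* An entry of [S] is at most 1 and is zero unless the entry of [M] is at least
   [m], so [M - e *: S] is nonnegative for [e <= m]; halving makes [e < 1]. *)
pose m := \big[Order.min/1]_k M k (s k).
have m0 : 0 < m by rewrite lt_bigmin.
have m1 : m <= 1 by exact: bigmin_le_id.
have mM k l : s k = l -> m <= M k l by move=> <-; exact: bigmin_le.
pose e := m / 2.
have e01 : 0 < e < 1 by rewrite /e; lra.
have eSM k l : e * S k l <= M k l.
  rewrite SE /e; case: eqP => [/mM|_]; case: eqP => [/mM|_] /=;
    rewrite -?Minv; have := M0 k l; lra.
pose N := (1 - e)^-1 *: (M - e *: S).
have NE k l : N k l = (1 - e)^-1 * (M k l - e * S k l) by rewrite !mxE.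
have ne : 1 - e != 0 by apply/eqP; lra.
have IN : iBirkhoff phi psi N.
  split; last by move=> k l; rewrite !NE -Minv -Sinv.
  split=> [k l|k|l].
  - by rewrite NE mulr_ge0 ?invr_ge0 ?subr_ge0 ?eSM //; lra.
  - under eq_bigr do rewrite NE.
    by rewrite -mulr_sumr sumrB -mulr_sumr Mr Sr mulr1 mulVf.
  - under eq_bigr do rewrite NE.
    by rewrite -mulr_sumr sumrB -mulr_sumr Mc Sc mulr1 mulVf.
have [<- _] : S = M /\ N = M.
  apply: (Mext S N e) => //; rewrite /N scalerA mulfV // scale1r.
  by rewrite addrC subrK.
rewrite SE; case: (s i == j); case: (s (phi i) == psi j); rewrite /= !inE.
- by rewrite mulVf ?pnatr_eq0 // eqxx !orbT.
- by rewrite addr0 mulr1 eqxx orbT.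
- by rewrite add0r mulr1 eqxx orbT.
- by rewrite addr0 mulr0 eqxx.
Qed.

Section Cost.
Variables alpha beta : 'I_d -> R[i].

Lemma costZD (a : R) M N :
  cost alpha beta (a *: (M + N)) = a * (cost alpha beta M + cost alpha beta N).
Proof.
rewrite /cost -mulrDr mulrCA; congr (_ * _).
rewrite -big_split /= mulr_sumr; apply: eq_bigr => i _.
rewrite -big_split /= mulr_sumr; apply: eq_bigr => j _.
by rewrite !mxE; ring.
Qed.

Lemma cost_symmetrize phi psi M :
  (forall i, alpha (phi i) = (alpha i)^*) ->
  (forall j, beta (psi j) = (beta j)^*) ->
  cost alpha beta (symmetrize phi psi M) = cost alpha beta M.
Proof.
move=> phiP psiP; rewrite costZD.
have -> : cost alpha beta (twist phi psi M) = cost alpha beta M.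
  rewrite /cost; congr (_ * _); rewrite [RHS](reindex_inj (@perm_inj _ phi)).
  apply: eq_bigr => i _; rewrite [RHS](reindex_inj (@perm_inj _ psi)).
  apply: eq_bigr => j _.
  by rewrite mxE phiP psiP -rmorphB norm_conjC.
by field.
Qed.

(** A minimizer over the whole polytope stays one after symmetrization, which
brings it into the invariant part. *)
Lemma cost_iBirkhoff_min phi psi M :
  involutive phi -> involutive psi ->
  (forall i, alpha (phi i) = (alpha i)^*) ->
  (forall j, beta (psi j) = (beta j)^*) ->
  minimizes (iBirkhoff phi psi) (cost alpha beta) M ->
  W2sq alpha beta = cost alpha beta M.
Proof.
move=> phiK psiK phiP psiP [[BM _] Mmin].
have [N [BN Nmin] <-] := W2sq_min alpha beta.
apply/eqP; rewrite eq_le Nmin //= -(cost_symmetrize N phiP psiP).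
by apply: Mmin; exact: iBirkhoff_symmetrize.
Qed.

End Cost.
End SymmetricBirkhoff.

(** * Rationality of symmetric expressions in the roots *)

Section Rationality.
Variable F : numFieldType.
Implicit Types x y : F.

Definition rational x := exists r : rat, ratr r = x.

Lemma rational_ratr r : rational (ratr r).
Proof. by exists r. Qed.

Lemma rationalM x y : rational x -> rational y -> rational (x * y).
Proof. by move=> [r <-] [s <-]; exists (r * s); rewrite rmorphM. Qed.

Lemma rational_sum (I : Type) (s : seq I) (P : pred I) (f : I -> F) :
  (forall i, rational (f i)) -> rational (\sum_(i <- s | P i) f i).
Proof.
move=> rf; elim/big_ind: _ => //; first by exists 0; rewrite rmorph0.
by move=> _ _ [r <-] [t <-]; exists (r + t); rewrite rmorphD.
Qed.

Lemma poly_rational (p : {poly F}) :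
  (forall k, rational p`_k) -> exists h : {poly rat}, map_poly ratr h = p.
Proof.
move=> rp; have [c cE] := choice rp; exists (\poly_(k < size p) c k).
apply/polyP=> k; rewrite coef_map coef_poly; case: ltnP => [_|le] //=.
by rewrite rmorph0 nth_default.
Qed.

Lemma mmap_comp n m (h : 'I_m -> F) (f : {mpoly rat[n]})
    (t : n.-tuple {mpoly rat[m]}) :
  mmap ratr h (f \mPo t) = mmap ratr (fun i => mmap ratr h (tnth t i)) f.
Proof.
rewrite comp_mpolyE raddf_sum; apply: eq_bigr => k _ /=.
rewrite mmapZ rmorph_prod; congr (_ * _); apply: eq_bigr => i _.
by rewrite rmorphXn.
Qed.

Lemma rational_mmap n (h : 'I_n -> F) (f : {mpoly rat[n]}) :
  (forall i, rational (h i)) -> rational (mmap ratr h f).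
Proof.
move=> rh; apply: rational_sum => m; apply: rationalM; first by exists f@_m.
rewrite /mmap1; elim/big_ind: _ => [|x y|i _]; first by exists 1; rewrite rmorph1.
  exact: rationalM.
by have [r <-] := rh i; exists (r ^+ m i); rewrite rmorphXn.
Qed.

(** Up to sign, these are the coefficients of [p]. *)
Lemma rational_mesym n (p : {poly rat}) (a : 'I_n -> F) k :
  map_poly ratr p = \prod_(i < n) ('X - (a i)%:P) -> (k <= n)%N ->
  rational (mmap ratr a (mesym n rat k)).
Proof.
move=> pE le_kn; have lt_kn : (k < n.+1)%N by [].
have := mroots_coeff [tuple a i | i < n] (Ordinal lt_kn).
rewrite big_tuple /=; under eq_bigr do rewrite tnth_mktuple.
rewrite -pE coef_map /= => e.
have -> : mmap ratr a (mesym n rat k) = (-1) ^+ k * ratr p`_(n - k).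
  rewrite e mulrA -exprMn mulrNN mulr1 expr1n mul1r !mesymE !raddf_sum.
  apply: eq_bigr => h _; rewrite /= mmapX mevalX.
  by apply: eq_bigr => i _; rewrite tnth_mktuple.
by exists ((-1) ^+ k * p`_(n - k)); rewrite rmorphM rmorphXn rmorphN1.
Qed.

Lemma rational_symmetric n (p : {poly rat}) (a : 'I_n -> F)
    (f : {mpoly rat[n]}) :
  map_poly ratr p = \prod_(i < n) ('X - (a i)%:P) -> f \is symmetric ->
  rational (mmap ratr a f).
Proof.
move=> pE /sym_fundamental[t [<- _]]; rewrite mmap_comp.
apply: rational_mmap => i; rewrite tnth_mktuple.
exact: rational_mesym pE _.
Qed.

(** The sum is the value at [a] of the symmetrization of a monomial. *)
Lemma rational_sum_perm n (p : {poly rat}) (a : 'I_n -> F) (m : 'I_n -> nat) :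
  map_poly ratr p = \prod_(i < n) ('X - (a i)%:P) ->
  rational (\sum_(s : 'S_n) \prod_i a (s i) ^+ m i).
Proof.
move=> pE; pose f : {mpoly rat[n]} := \sum_(s : 'S_n) \prod_i 'X_(s i) ^+ m i.
have -> : \sum_(s : 'S_n) \prod_i a (s i) ^+ m i = mmap ratr a f.
  rewrite raddf_sum; apply: eq_bigr => s _ /=; rewrite rmorph_prod.
  by apply: eq_bigr => i _; rewrite rmorphXn /= mmapX mmap1U.
apply: rational_symmetric pE _; apply/issymP=> t.
rewrite raddf_sum [RHS](reindex_inj (mulIg t)); apply: eq_bigr => s _ /=.
rewrite rmorph_prod; apply: eq_bigr => i _.
by rewrite rmorphXn /= /msym mmapX mmap1U permM.
Qed.

End Rationality.

Section Evaluation.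
Variables (F : numFieldType) (d : nat).
Implicit Types (alpha beta : 'I_d -> F) (s : 'S_d * 'S_d).

(** The assignment of values to the variables that underlies [Phi]. *)
Definition valuation alpha beta (k : 'I_(d + d)) : F :=
  match split k with inl i => alpha i | inr j => beta j end.

Lemma valuation_lshift alpha beta i :
  valuation alpha beta (lshift d i) = alpha i.
Proof. by rewrite /valuation -[lshift d i]/(unsplit (inl i)) unsplitK. Qed.

Lemma valuation_rshift alpha beta j :
  valuation alpha beta (rshift d j) = beta j.
Proof. by rewrite /valuation -[rshift d j]/(unsplit (inr j)) unsplitK. Qed.

(** For a monomial in the variables x and y, the sum over pairs of permutations
factors into a sum over permutations of the [alpha i] times one over
permutations of the [beta j]. *)
Lemma rational_sum_valuation (p q : {poly rat}) alpha beta (f : A d) :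
  map_poly ratr p = \prod_(i < d) ('X - (alpha i)%:P) ->
  map_poly ratr q = \prod_(j < d) ('X - (beta j)%:P) ->
  rational (\sum_(s : 'S_d * 'S_d)
    mmap ratr (valuation (alpha \o s.1) (beta \o s.2)) f).
Proof.
move=> pE qE; rewrite exchange_big; apply: rational_sum => m /=.
rewrite -mulr_sumr; apply: rationalM; first exact: rational_ratr.
have -> : \sum_(s : 'S_d * 'S_d) mmap1 (valuation (alpha \o s.1) (beta \o s.2)) m
  = (\sum_(s : 'S_d) \prod_i alpha (s i) ^+ m (lshift d i))
    * (\sum_(s : 'S_d) \prod_j beta (s j) ^+ m (rshift d j)).
  rewrite big_distrlr /= pair_bigA /=; apply: eq_bigr => s _.
  rewrite /mmap1 big_split_ord /=; congr (_ * _); apply: eq_bigr => i _.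
    by rewrite valuation_lshift.
  by rewrite valuation_rshift.
by apply: rationalM; [apply: rational_sum_perm pE | apply: rational_sum_perm qE].
Qed.

(** An invariant value is the average of its conjugates under permutations of
the roots. *)
Lemma rational_valuation (p q : {poly rat}) alpha beta (f : A d) :
  map_poly ratr p = \prod_(i < d) ('X - (alpha i)%:P) ->
  map_poly ratr q = \prod_(j < d) ('X - (beta j)%:P) ->
  (forall s : 'S_d * 'S_d, mmap ratr (valuation (alpha \o s.1) (beta \o s.2)) f
     = mmap ratr (valuation alpha beta) f) ->
  rational (mmap ratr (valuation alpha beta) f).
Proof.
move=> pE qE inv; have := rational_sum_valuation f pE qE.
under eq_bigr do rewrite inv.
rewrite sumr_const -mulr_natr; set n := #|_| => -[r rE].
have n0 : n%:R != 0 :> F by rewrite pnatr_eq0 -lt0n; apply/card_gt0P; exists 1%g.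
by exists (r / n%:R); rewrite fmorph_div rmorph_nat /= rE mulfK.
Qed.

Lemma mmap_polyact alpha beta s (f : A d) :
  mmap ratr (valuation alpha beta) (polyact s f)
  = mmap ratr (valuation (alpha \o s.1) (beta \o s.2)) f.
Proof.
rewrite mmap_comp; congr mmap; apply: funext => k.
rewrite tnth_mktuple /X_ mmapX mmap1U /valuation unsplitK.
by case: (split k).
Qed.

Lemma mmap_X_ alpha beta v : mmap ratr (valuation alpha beta) (X_ v) =
  match v with inl i => alpha i | inr j => beta j end.
Proof. by rewrite /X_ mmapX mmap1U /valuation unsplitK. Qed.

End Evaluation.

(** * Products over cosets and algebraic degree *)

(** Right translation by [s] permutes the right cosets of [H], and [f] is constant
on each of them, so the choice of representatives does not matter. *)
Lemma prod_rcosets_translate (gT : finGroupType) (H : {group gT})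
    (R : comNzRingType) (f : gT -> R) (s : gT) :
  (forall a x, a \in H -> f (a * x)%g = f x) ->
  \prod_(C in rcosets H [set: gT]) f (repr C * s)%g
  = \prod_(C in rcosets H [set: gT]) f (repr C).
Proof.
move=> fH.
have fr x : f (repr (H :* x)%g) = f x by case: repr_rcosetP => a aH; exact: fH.
have sK : cancel (fun C => C :* s)%g (fun C => C :* s^-1)%g.
  by move=> C; rewrite -rcosetM mulgV rcoset1.
rewrite [RHS](reindex_inj (can_inj sK)); apply: eq_big => [C|C].
  apply/rcosetsP/rcosetsP=> -[x _ e].
    by exists (x * s)%g; rewrite ?inE // e rcosetM.
  exists (x * s^-1)%g; rewrite ?inE // rcosetM -e -rcosetM.
  by rewrite mulgV rcoset1.
case/rcosetsP=> x _ ->; rewrite -rcosetM fr.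
by case: repr_rcosetP => a aH; rewrite -mulgA fH.
Qed.

Lemma has_alg_degree_le (F : numFieldType) (x : F) (h : {poly rat}) :
  h != 0 -> root (map_poly ratr h) x ->
  exists2 n, has_alg_degree x n & (n <= (size h).-1)%N.
Proof.
move=> h0 hx.
pose P n := `[< exists r : {poly rat},
  [/\ r != 0, root (map_poly ratr r) x & size r = n] >].
have exP : exists n, P n by exists (size h); apply/asboolP; exists h.
have [n /asboolP[r [r0 rx <-]] nmin] := ex_minnP exP.
have lr : (lead_coef r)^-1 != 0 by rewrite invr_eq0 lead_coef_eq0.
exists (size r).-1; last first.
  have : (size r <= size h)%N by apply: nmin; apply/asboolP; exists h.
  by case: (size r) => // k; case: (size h).
exists ((lead_coef r)^-1 *: r); last first.
  by rewrite size_scale // prednK // lt0n size_poly_eq0.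
split.
- by rewrite monicE lead_coefZ mulVf // lead_coef_eq0.
- by rewrite map_polyZ rootZ ?fmorph_eq0.
- move=> u u0 ux; rewrite size_scale //; apply: nmin.
  by apply/asboolP; exists u.
Qed.

(** * The orbit polynomial of the optimal plan *)

Section OrbitPolynomial.
Variables (R : realType) (d : nat).
Implicit Types (alpha beta : 'I_d -> R[i]) (g s : 'S_d * 'S_d).
Variables (M : 'M[R]_d) (phi psi : 'S_d).

Local Notation G := (AutI M phi psi).

Definition fM_value alpha beta g : R[i] :=
  d%:R^-1 * \sum_i \sum_j ratr (ratM M i j) *
    ((alpha (g.1 i) - beta (g.2 j))
     * (alpha (g.1 (phi i)) - beta (g.2 (psi j)))).

Lemma mmap_fM alpha beta g :
  mmap ratr (valuation alpha beta) (polyact g (fM M phi psi))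
  = fM_value alpha beta g.
Proof.
rewrite mmap_polyact /fM mmapZ fmorphV rmorph_nat; congr (_ * _).
rewrite raddf_sum; apply: eq_bigr => i _ /=.
rewrite raddf_sum; apply: eq_bigr => j _ /=.
by rewrite mmapZ; congr (_ * _); rewrite rmorphM !rmorphB /= !mmap_X_.
Qed.

Lemma fM_value_comp alpha beta s g :
  fM_value (alpha \o s.1) (beta \o s.2) g = fM_value alpha beta (g * s)%g.
Proof.
congr (_ * _); apply: eq_bigr => i _; apply: eq_bigr => j _.
by rewrite /= !permM.
Qed.

Lemma AutI_edges g i j : g \in G -> edges M (g.1 i) (g.2 j) = edges M i j.
Proof.
rewrite inE => /andP[/forallP/(_ (inl i))/forallP/(_ (inr j))/eqP e _].
exact: e.
Qed.

Lemma AutI_phi g i : g \in G -> g.1 (phi i) = phi (g.1 i).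
Proof. by rewrite inE => /andP[_ /forallP/(_ (inl i))/eqP[]]. Qed.

Lemma AutI_psi g j : g \in G -> g.2 (psi j) = psi (g.2 j).
Proof. by rewrite inE => /andP[_ /forallP/(_ (inr j))/eqP[]]. Qed.

(** An automorphism only reindexes the double sum, because it preserves the
number of edges and commutes with the involution. *)
Lemma fM_value_AutI alpha beta a g :
  a \in G -> fM_value alpha beta (a * g)%g = fM_value alpha beta g.
Proof.
move=> aG; congr (_ * _).
rewrite [RHS](reindex_inj (@perm_inj _ a.1)); apply: eq_bigr => i _.
rewrite [RHS](reindex_inj (@perm_inj _ a.2)); apply: eq_bigr => j _.
by rewrite /ratM AutI_edges // -AutI_phi // -AutI_psi // !permM.
Qed.

Lemma Phi_hM alpha beta : Phi alpha beta (hM M phi psi)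
  = \prod_(C in rcosets G [set: 'S_d * 'S_d])
      ((fM_value alpha beta (repr C))%:P - 'X).
Proof.
rewrite /Phi -/(valuation alpha beta) rmorph_prod; apply: eq_bigr => C _.
by rewrite rmorphB /= map_polyX map_polyC /= mmap_fM.
Qed.

Lemma coef_Phi alpha beta (h : {poly A d}) k :
  (Phi alpha beta h)`_k = mmap ratr (valuation alpha beta) h`_k.
Proof. by rewrite coef_map. Qed.

(** Permuting the roots by [s] amounts to translating the cosets by [s]. *)
Lemma Phi_hM_comp alpha beta s :
  Phi (alpha \o s.1) (beta \o s.2) (hM M phi psi) = Phi alpha beta (hM M phi psi).
Proof.
rewrite !Phi_hM; under eq_bigr do rewrite fM_value_comp.
apply: (prod_rcosets_translate (f := fun g => (fM_value alpha beta g)%:P - 'X)).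
by move=> a g aG; rewrite fM_value_AutI.
Qed.

Lemma Phi_hM_rational alpha beta (p q : {poly rat}) :
  map_poly ratr p = \prod_(i < d) ('X - (alpha i)%:P) ->
  map_poly ratr q = \prod_(j < d) ('X - (beta j)%:P) ->
  exists h : {poly rat}, map_poly ratr h = Phi alpha beta (hM M phi psi).
Proof.
move=> pE qE; apply: poly_rational => k; rewrite coef_Phi.
apply: rational_valuation pE qE _ => s.
by rewrite -!coef_Phi Phi_hM_comp.
Qed.

Lemma size_Phi_hM alpha beta : size (Phi alpha beta (hM M phi psi)) =
  #|rcosets G [set: 'S_d * 'S_d]|.+1.
Proof.
have sz (c : R[i]) : size (c%:P - 'X) = 2 by rewrite -opprB size_polyN size_XsubC.
rewrite Phi_hM size_prod => [|C _]; last by rewrite -size_poly_eq0 sz.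
under eq_bigr do rewrite sz.
by rewrite sum_nat_const muln2 -addnn subSn ?leq_addl // addnK.
Qed.

Lemma card_rcosets_AutI :
  #|rcosets G [set: 'S_d * 'S_d]|%:R = (d`! ^ 2)%:R / #|G|%:R :> rat.
Proof.
have e : (d`! ^ 2)%:R = #|G|%:R * #|rcosets G [set: 'S_d * 'S_d]|%:R :> rat.
  rewrite -natrM -[#|rcosets _ _|]/#|[set: _] : G|%g Lagrange ?finset.subsetT //.
  by rewrite cardsT card_prod card_Sn.
by rewrite e mulrC mulKf // pnatr_eq0 -lt0n; exact: cardG_gt0 (AutI_group _ _ _).
Qed.

(** The coset of the identity gives a vanishing factor. *)
Lemma root_Phi_hM alpha beta : root (Phi alpha beta (hM M phi psi))
  (fM_value alpha beta 1%g).
Proof.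
have GG : (G : {set _}) \in rcosets G [set: 'S_d * 'S_d].
  by apply/rcosetsP; exists 1%g; rewrite ?inE ?rcoset1.
rewrite Phi_hM /root horner_prod; apply/eqP.
rewrite (bigD1 (G : {set _})) //= hornerD hornerN hornerC hornerX.
by rewrite -[repr _]mulg1 fM_value_AutI ?subrr ?mul0r // (mem_repr 1%g) ?group1.
Qed.

(** Conjugation by [phi] and [psi] turns each product of differences into the
squared modulus of [alpha i - beta j]. *)
Lemma fM_value_cost alpha beta :
  (forall i j, M i j \in [:: 0; 2^-1; 1]) ->
  (forall i, alpha (phi i) = (alpha i)^*) ->
  (forall j, beta (psi j) = (beta j)^*) ->
  fM_value alpha beta 1%g = (cost alpha beta M)%:C%C.
Proof.
move=> Mh phiP psiP; rewrite /cost rmorphM fmorphV rmorph_nat; congr (_ * _).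
rewrite rmorph_sum; apply: eq_bigr => i _ /=.
rewrite rmorph_sum; apply: eq_bigr => j _ /=.
rewrite !perm1 phiP psiP -rmorphB -normCK [RHS]rmorphM [X in _ = _ * X]rmorphXn.
(* The moduli on both sides agree by computation; the entries of [M] remain. *)
congr (_ * _).
by rewrite -(halfE (Mh i j)).2 fmorph_rat.
Qed.

End OrbitPolynomial.

Theorem theorem4p5 (R : realType) (d : nat) (p q : {poly rat})
    (alpha beta : 'I_d -> R[i]) (phi psi : 'S_d) (M : 'M[R]_d)
    (p_monic : p \is monic) (p_deg : size p = d.+1)
    (q_monic : q \is monic) (q_deg : size q = d.+1)
    (p_roots : map_poly ratr p = \prod_(i < d) ('X - (alpha i)%:P))
    (q_roots : map_poly ratr q = \prod_(j < d) ('X - (beta j)%:P))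
    (alpha_inj : injective alpha) (beta_inj : injective beta)
    (phiP : forall i, alpha (phi i) = (alpha i)^*)
    (psiP : forall j, beta (psi j) = (beta j)^*)
    (M_vertex : is_vertex (iBirkhoff phi psi) M)
    (M_min : minimizes (iBirkhoff phi psi) (cost alpha beta) M) :
  [/\ exists h : {poly rat},
        map_poly ratr h = Phi alpha beta (hM M phi psi),
      root (Phi alpha beta (hM M phi psi)) (W2sq alpha beta)%:C%C
    & exists2 n, has_alg_degree (W2sq alpha beta) n
        & n%:R <= (d`! ^ 2)%:R / #|AutI M phi psi|%:R :> rat].
Proof.
have phiK : involutive phi.
  by move=> i; apply: alpha_inj; rewrite !phiP conjCK.
have psiK : involutive psi.
  by move=> j; apply: beta_inj; rewrite !psiP conjCK.
have Mh i j : M i j \in [:: 0; 2^-1; 1].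
  exact: vertex_half_integral phiK psiK M_vertex.
have [h hE] := Phi_hM_rational M phi psi p_roots q_roots.
have rootW : root (Phi alpha beta (hM M phi psi)) (W2sq alpha beta)%:C%C.
  rewrite (cost_iBirkhoff_min phiK psiK phiP psiP M_min).
  by rewrite -(fM_value_cost Mh phiP psiP) root_Phi_hM.
split=> //; first by exists h.
have szh : size h = #|rcosets (AutI M phi psi) [set: 'S_d * 'S_d]|.+1.
  by rewrite -(size_Phi_hM M phi psi alpha beta) -hE size_map_poly.
have h0 : h != 0 by rewrite -size_poly_eq0 szh.
(* [h] has rational coefficients, so its root can be read in [R]. *)
have rooth : root (map_poly ratr h) (W2sq alpha beta).
  rewrite -(fmorph_root (real_complex R)) -map_poly_comp.
  rewrite (eq_map_poly (g := ratr)) ?hE // => x.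
  exact: fmorph_rat.
have [n degn le_n] := has_alg_degree_le h0 rooth.
exists n => //; rewrite -card_rcosets_AutI ler_nat.
by rewrite szh in le_n.
Qed.
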